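(* For $n\ge0$ and $i=1,2$, $$C_n^i(x,0,s,h\,|\,\alpha,p,q)=\sum_{k=0}^{\lfloor n/2\rfloor}\gamma^i_{n,k}(0)\,x^k(1+x)^{n-2k},$$ where $$\gamma^1_{n,k}(0)=\sum_{\sigma\in\mathcal{D}_{n,k}^0}s^{\mathrm{inv}(\sigma)}h^{\mathrm{depth}(\sigma)}\alpha^{\mathrm{rmin}(\sigma)+\mathrm{lmax}(\sigma)}p^{\mathrm{cros}(\sigma)}q^{\mathrm{nest}(\sigma)},$$ $$\gamma^2_{n,k}(0)=\sum_{\sigma\in\mathcal{D}_{n,k}^0}s^{\mathrm{inv}(\sigma)}h^{\mathrm{depth}(\sigma)}\alpha^{\mathrm{rmin}(\sigma)+\mathrm{lmax}(\sigma)}p^{\mathrm{cros}(\sigma)+\mathrm{drop}(\sigma)}q^{\mathrm{nest}(\sigma)}.$$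
   Context: For $\sigma\in\mathfrak{S}_n$ (permutations of $[n]$, $\sigma_i=\sigma(i)$): $\mathrm{exc}(\sigma)=\#\{i:\sigma(i)>i\}$, $\mathrm{drop}(\sigma)=\#\{i:\sigma(i)<i\}$, $\mathrm{fix}(\sigma)=\#\{i:\sigma(i)=i\}$, $\mathrm{cda}(\sigma)=\#\{i:\sigma^{-1}(i)<i<\sigma(i)\}$, $\mathrm{inv}(\sigma)=\#\{i<j:\sigma_i>\sigma_j\}$, $\mathrm{depth}(\sigma)=\sum_{\sigma(i)>i}(\sigma(i)-i)$; $\mathrm{lmax}(\sigma)$ is the number of letters larger than all letters to their left, $\mathrm{rmin}(\sigma)$ the number of letters smaller than all letters to their right; $$\mathrm{cros}(\sigma)=\#\{(i,j)\in[n]^2:(i<j\le\sigma_i<\sigma_j)\lor(i>j>\sigma_i>\sigma_j)\},$$ $$\mathrm{nest}(\sigma)=\#\{(i,j)\in[n]^2:(i<j\le\sigma_j<\sigma_i)\lor(i>j>\sigma_j>\sigma_i)\}.$$ Let $\mathcal{D}_n=\{\sigma\in\mathfrak{S}_n:\mathrm{fix}(\sigma)=0\}$ be the set of derangements of $[n]$ (for $n=0$, the empty permutation, of weight $1$), $\mathcal{D}_{n,k}^0=\{\sigma\in\mathcal{D}_n:\mathrm{cda}(\sigma)=0,\ \mathrm{exc}(\sigma)=k\}$, and $$C_n^1(x,0,s,h\,|\,\alpha,p,q)=\sum_{\sigma\in\mathcal{D}_n}x^{\mathrm{exc}(\sigma)}s^{\mathrm{inv}(\sigma)}h^{\mathrm{depth}(\sigma)}\alpha^{\mathrm{lmax}(\sigma)+\mathrm{rmin}(\sigma)}p^{\mathrm{cros}(\sigma)-\mathrm{cda}(\sigma)}q^{\mathrm{nest}(\sigma)},$$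 $$C_n^2(x,0,s,h\,|\,\alpha,p,q)=\sum_{\sigma\in\mathcal{D}_n}x^{\mathrm{exc}(\sigma)}s^{\mathrm{inv}(\sigma)}h^{\mathrm{depth}(\sigma)}\alpha^{\mathrm{lmax}(\sigma)+\mathrm{rmin}(\sigma)}p^{\mathrm{cros}(\sigma)+\mathrm{drop}(\sigma)}q^{\mathrm{nest}(\sigma)}.$$ *)

(* Defs.v *)
From mathcomp Require Import all_boot all_algebra all_fingroup.

Set Implicit Arguments.
Unset Strict Implicit.
Unset Printing Implicit Defensive.

(* A permutation of [n] = {1, ..., n} is an element of 'S_n, acting on
   {0, ..., n-1}: every statistic below only compares or subtracts positions
   and letters, so the shift by one does not affect it. *)

Definition exc n (sigma : 'S_n) : nat := #|[set i : 'I_n | i < sigma i]|.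

Definition ndrop n (sigma : 'S_n) : nat := #|[set i : 'I_n | sigma i < i]|.

Definition nfix n (sigma : 'S_n) : nat := #|[set i : 'I_n | sigma i == i]|.

Definition cda n (sigma : 'S_n) : nat :=
  #|[set i : 'I_n | (sigma^-1)%g i < i < sigma i]|.

Definition inv n (sigma : 'S_n) : nat :=
  #|[set ij : 'I_n * 'I_n | (ij.1 < ij.2) && (sigma ij.2 < sigma ij.1)]|.

Definition depth n (sigma : 'S_n) : nat :=
  \sum_(i < n | i < sigma i) (sigma i - i).

(* Letters are counted through their positions. *)
Definition lmax n (sigma : 'S_n) : nat :=
  #|[set i : 'I_n | [forall j : 'I_n, (j < i) ==> (sigma j < sigma i)]]|.

Definition rmin n (sigma : 'S_n) : nat :=
  #|[set i : 'I_n | [forall j : 'I_n, (i < j) ==> (sigma i < sigma j)]]|.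

Definition cros n (sigma : 'S_n) : nat :=
  #|[set ij : 'I_n * 'I_n | let: (i, j) := ij in
      [&& i < j, j <= sigma i & sigma i < sigma j]
   || [&& i > j, j > sigma i & sigma i > sigma j]]|.

Definition nest n (sigma : 'S_n) : nat :=
  #|[set ij : 'I_n * 'I_n | let: (i, j) := ij in
      [&& i < j, j <= sigma j & sigma j < sigma i]
   || [&& i > j, j > sigma j & sigma j > sigma i]]|.

Definition derangements n : {set 'S_n} := [set sigma | nfix sigma == 0].

Definition derangements0 n k : {set 'S_n} :=
  [set sigma in derangements n | (cda sigma == 0) && (exc sigma == k)].

(* The truncated subtraction in the exponent [cros sigma - cda sigma] of [C1]
   below is therefore the genuine one. *)
Lemma cda_le_cros n (sigma : 'S_n) : cda sigma <= cros sigma.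
Proof.
pose f (i : 'I_n) := ((sigma^-1)%g i, i).
have f_inj : injective f by move=> i j [].
rewrite /cda -(card_imset _ f_inj).
apply/subset_leq_card/subsetP => ij /imsetP[i].
rewrite inE => /andP[lt1 lt2] ->.
by rewrite inE /f permKV lt1 lt2 leqnn.
Qed.

Local Open Scope ring_scope.

Definition C1 (R : comNzRingType) (n : nat) (x s h alpha p q : R) : R :=
  \sum_(sigma in derangements n)
     x ^+ exc sigma * s ^+ inv sigma * h ^+ depth sigma
     * alpha ^+ (lmax sigma + rmin sigma)
     * p ^+ (cros sigma - cda sigma) * q ^+ nest sigma.

Definition C2 (R : comNzRingType) (n : nat) (x s h alpha p q : R) : R :=
  \sum_(sigma in derangements n)
     x ^+ exc sigma * s ^+ inv sigma * h ^+ depth sigma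
     * alpha ^+ (lmax sigma + rmin sigma)
     * p ^+ (cros sigma + ndrop sigma) * q ^+ nest sigma.

Definition gamma1 (R : comNzRingType) (n k : nat) (s h alpha p q : R) : R :=
  \sum_(sigma in derangements0 n k)
     s ^+ inv sigma * h ^+ depth sigma
     * alpha ^+ (rmin sigma + lmax sigma)
     * p ^+ cros sigma * q ^+ nest sigma.

Definition gamma2 (R : comNzRingType) (n k : nat) (s h alpha p q : R) : R :=
  \sum_(sigma in derangements0 n k)
     s ^+ inv sigma * h ^+ depth sigma
     * alpha ^+ (rmin sigma + lmax sigma)
     * p ^+ (cros sigma + ndrop sigma) * q ^+ nest sigma.

(* Main.v *)
Require Import Defs.
From mathcomp Require Import all_boot all_algebra all_fingroup.
From mathcomp Require Import zify ring.

Set Implicit Arguments.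
Unset Strict Implicit.
Unset Printing Implicit Defensive.

Import GRing.Theory.

(** Cut a derangement [sigma] at every index [j] and record only its two links
between [j] and smaller indices: the position [sigma^-1 j] when it is below
[j], and the letter [sigma j] when it is below [j]. These records form a
history in the style of Foata and Zeilberger. Just before step [j] there is a
set of positions below [j] still waiting for a letter ([openP]) and a set of
letters below [j] still waiting for a position ([openV]). Step [j] closes some
element of the first set or none, and some element of the second set or none.
Derangements are exactly the histories made of legal steps that leave nothing
open at the end ([hist_of_inj], [hist_of_onto]). The two sets always have the
same size [k], the height of the underlying Motzkin path.

The statistics are local in the history. Closing an open position with [a]
open positions below it and [b] above it creates [a] nestings and [b]
crossings, and it creates a left-to-right maximum exactly when [a = 0].
Closing an open letter does the same with right-to-left minima. The depth is
the sum of the heights. The inversions are recovered from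
[inv = ndrop + cros + 2 nest] ([inv_split]). The lower half of [sigma] is the
upper half of [sigma^-1], so each count is made once and applied twice.

At height [k], a step that closes only a position is a cyclic double ascent,
and one that closes only a letter is a cyclic double descent. Both keep the
height, and summed over the choices of the closed element both give the same
total, because the choices are seen only through their rank in a set of size
[k] ([sum_rank_weight]). Hence if cyclic double ascents are marked by [y] and
cyclic double descents by [z], the generating function depends on [y + z] only
([sum_hist_balance], [sum_derangements]). Replacing [(y, z)] by [(0, y + z)]
kills the derangements with a cyclic double ascent. On the others, a
derangement with [k] excedances has [n - 2k] cyclic double descents, which
gives the factor [(y + z)^(n - 2k)] ([sum_derangements_cda0]). For both
polynomials [y = x z]: the value of [z] is [s] for the first, where the
exponent [cros - cda] counts the crossings with [j < sigma i] and the lower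
ones, and [s p] for the second, where every cyclic double ascent brings one
more crossing and every cyclic double descent one more drop. So
[y + z = (1 + x) z]. *)

(** * Histories *)

Section Histories.
Variable n : nat.

(** The pair at [j] is (the position holding the letter [j], the letter at the
position [j]), each one recorded only when it is smaller than [j]. *)
Definition history := {ffun 'I_n -> option 'I_n * option 'I_n}.

Implicit Types (g : history) (a b : 'I_n -> option 'I_n) (m j u c : 'I_n).

Definition up g j := (g j).1.
Definition dn g j := (g j).2.

(** For [a] the first and [b] the second component of a history this is the set
of positions below [k] that have no letter below [k]: such a position neither
took a smaller letter at its own step ([b]) nor was closed since ([a]).
Exchanging [a] and [b] gives the letters. *)
Definition unused a b (k : nat) : {set 'I_n} :=
  [set u : 'I_n | [&& u < k, b u == None &
                      [forall c : 'I_n, (c < k) ==> (a c != Some u)]]].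

Definition openP g := unused (up g) (dn g).
Definition openV g := unused (dn g) (up g).

Definition choosable (O : {set 'I_n}) (o : option 'I_n) :=
  if o is Some u then u \in O else true.

Definition legal g j :=
  choosable (openP g j) (up g j) && choosable (openV g j) (dn g j).

(** The steps from [k] on are filled with [(None, None)], so that histories of
every length live in one finite type and an induction on [k] is possible. *)
Definition valid (k : nat) g :=
  [forall j : 'I_n, if j < k then legal g j else g j == (None, None)].

Lemma unusedP a b k u :
  reflect [/\ u < k, b u = None & forall c, c < k -> a c <> Some u]
          (u \in unused a b k).
Proof.
rewrite inE; apply: (iffP and3P) => [[-> /eqP -> /forallP H]|[-> -> H]]; split=> //.
  by move=> c lc; apply/eqP; apply: (implyP (H c)).
by apply/forallP => c; apply/implyP => /H/eqP.
Qed.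

Lemma eq_unused a b a' b' (k : nat) :
  (forall j, j < k -> a j = a' j) -> (forall j, j < k -> b j = b' j) ->
  unused a b k = unused a' b' k.
Proof.
move=> ea eb; apply/setP => u; apply/unusedP/unusedP => -[lu bu cu]; split=> //.
- by rewrite -eb.
- by move=> c lc; rewrite -ea //; exact: cu.
- by rewrite eb.
- by move=> c lc; rewrite ea //; exact: cu.
Qed.

(** Step [m] removes the element that [a] closes and adds [m] itself unless [b]
already matched it, which gives the equation without subtraction. *)
Lemma card_unused_step a b m :
  (forall c, c <= m -> choosable (unused a b c) (a c)) ->
  #|unused a b m.+1| + isSome (a m) = #|unused a b m| + ~~ isSome (b m).
Proof.
move=> val.
have am_unused u c : c <= m -> a c = Some u -> u \in unused a b c.
  by move=> lc eq; have := val c lc; rewrite eq.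
have m_notin : m \notin unused a b m by apply/unusedP => -[]; rewrite ltnn.
have m_in : (m \in unused a b m.+1) = ~~ isSome (b m).
  apply/unusedP/idP => [[_ -> //]|]; case eb: (b m) => [//|] _.
  split=> // c lc eq.
  by have /unusedP[] := am_unused _ _ lc eq; rewrite ltnNge -ltnS lc.
have unused_in u : u != m ->
    (u \in unused a b m.+1) = (u \in unused a b m) && (a m != Some u).
  move=> nu; apply/unusedP/andP => [[lu bu H]|[/unusedP[lu bu H] /eqP am]].
    split; last by apply/eqP; apply: H.
    apply/unusedP; split=> [|//|c lc]; last by apply: H; exact: ltnW.
    by rewrite ltn_neqAle nu -ltnS.
  split=> [|//|c]; first exact: ltnW.
  rewrite ltnS leq_eqVlt => /orP[/eqP/val_inj -> //|]; exact: H.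
rewrite (cardsD1 m (unused a b m.+1)) m_in -addnA addnC; congr (_ + _).
case am: (a m) => [u|] /=; last first.
  rewrite addn0; apply: eq_card => w; rewrite in_setD1.
  case: eqVneq => [->|nw] /=; first by rewrite (negPf m_notin).
  by rewrite unused_in // am andbT.
rewrite [RHS](cardsD1 u) (am_unused u m) // addnC; congr (_ + _).
apply: eq_card => w; rewrite !in_setD1.
have [->|nw] := eqVneq w m; first by rewrite (negPf m_notin) andbF.
rewrite unused_in // am /= andbC; congr (_ && _).
by rewrite eq_sym.
Qed.

Lemma validP (k : nat) g :
  reflect ((forall j, j < k -> legal g j) /\
           (forall j, k <= j -> g j = (None, None))) (valid k g).
Proof.
apply: (iffP forallP) => [H|[H1 H2] j].
  by split=> j lj; have := H j; rewrite ?lj // ltnNge lj => /eqP.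
by case: ltnP => [/H1 //|/H2 ->].
Qed.

Lemma card_open_step g m : (forall j, j <= m -> legal g j) ->
  #|openP g m.+1| + isSome (up g m) = #|openP g m| + ~~ isSome (dn g m) /\
  #|openV g m.+1| + isSome (dn g m) = #|openV g m| + ~~ isSome (up g m).
Proof.
by move=> H; split; apply: card_unused_step => c /H/andP[].
Qed.

(** Positions and letters are matched in pairs, so equally many of each wait. *)
Lemma card_openPV g (k : nat) : k <= n -> (forall j, j < k -> legal g j) ->
  #|openP g k| = #|openV g k|.
Proof.
elim: k => [|k IH] lk H.
  by rewrite !eq_card0 // => u; apply/unusedP => -[].
have := @card_open_step g (Ordinal lk) H => /=.
have := IH (ltnW lk) (fun j lj => H j (ltnW lj)).
case: isSome; case: isSome => /=; lia.
Qed.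

Definition upd g m o : history := [ffun j => if j == m then o else g j].

Lemma upd_ltE g m o j : j < m -> upd g m o j = g j.
Proof. by rewrite ffunE; case: eqVneq => [->|//]; rewrite ltnn. Qed.

Lemma updE g m o : upd g m o m = o.
Proof. by rewrite ffunE eqxx. Qed.

Lemma open_upd g m o (k : nat) : k <= m ->
  openP (upd g m o) k = openP g k /\ openV (upd g m o) k = openV g k.
Proof.
by move=> le; split; apply: eq_unused => j lj;
  rewrite /up /dn upd_ltE //; exact: leq_trans lj le.
Qed.

Lemma legal_upd g m o j : j < m -> legal (upd g m o) j = legal g j.
Proof.
move=> lt; rewrite /legal; have [-> ->] := open_upd g o (ltnW lt).
by rewrite /up /dn upd_ltE.
Qed.

(** A history that stops after step [m] is a history that stops before [m]
together with a choice of what [m] closes. That the two choices range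
independently, over sets fixed by the past, is what makes histories easier to
sum over than permutations. *)
Lemma sum_hist_step (V : nmodType) (m : 'I_n) (F : history -> V) :
  (\sum_(g | valid m.+1 g) F g =
   \sum_(g | valid m g) \sum_(o | choosable (openP g m) o.1 &&
                                 choosable (openV g m) o.2) F (upd g m o))%R.
Proof.
rewrite pair_big_dep /=.
rewrite (reindex_onto (fun t : history * _ => upd t.1 m t.2)
          (fun g => (upd g m (None, None), g m))) /=; last first.
  by move=> g _; apply/ffunP => j; rewrite !ffunE; case: eqVneq => [->|].
apply: eq_bigl => -[g o] /=; rewrite xpair_eqE updE eqxx andbT.
apply/andP/andP => [[/validP[H1 H2] /eqP eq]|[/validP[H1 H2] leg]].
  have gm : g m = (None, None) by rewrite -eq updE.
  split.
    apply/validP; split=> j lj; first by rewrite -(@legal_upd g m o j lj) H1 // ltnW.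
    have [->//|nj] := eqVneq j m.
    have /H2 : m < j by rewrite ltn_neqAle eq_sym nj.
    by rewrite ffunE (negPf nj).
  have := H1 m (ltnSn m); rewrite /legal.
  by have [-> ->] := open_upd g o (leqnn m); rewrite /up /dn updE.
split.
  apply/validP; split=> j.
    rewrite ltnS leq_eqVlt => /orP[/eqP/val_inj ->|lj]; last by rewrite legal_upd // H1.
    rewrite /legal; have [-> ->] := open_upd g o (leqnn m).
    by rewrite /up /dn updE.
  by move=> lj; rewrite ffunE; case: eqVneq lj => [->|_ /ltnW/H2 //]; rewrite ltnn.
apply/eqP/ffunP => j; rewrite !ffunE; case: eqVneq => [->|//].
by rewrite H2.
Qed.

(** * Exchanging double ascents and double descents *)

Local Open Scope ring_scope.

Section Weights.
Variables (R : comNzRingType) (v : nat -> nat -> R) (d : nat -> R).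

Definition rank_weight (O : {set 'I_n}) (o : option 'I_n) : R :=
  if o is Some u
  then v #|[set w in O | (w < u)%N]| #|[set w in O | (u < w)%N]| else 1.

(** A step that closes nothing is a cyclic valley; one that closes both a
position and a letter is a cyclic peak. Valleys need no mark, being as many as
the peaks. *)
Definition type_weight (y z t : R) (closesP closesV : bool) : R :=
  match closesP, closesV with
  | true, false => y | false, true => z | true, true => t | _, _ => 1
  end.

Definition step_weight (y z t : R) g j : R :=
  d #|openP g j| * rank_weight (openP g j) (up g j)
  * rank_weight (openV g j) (dn g j)
  * type_weight y z t (isSome (up g j)) (isSome (dn g j)).

Definition rank_sum (k : nat) : R := \sum_(a < k) v a (k.-1 - a)%N.

(** The number of smaller elements is a bijection from [O] onto the integers
below [#|O|], so the sum forgets which set [O] is. *)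
Lemma sum_rank_weight (O : {set 'I_n}) :
  \sum_(u in O) rank_weight O (Some u) = rank_sum #|O|.
Proof.
have below u : u \in O -> (#|[set w in O | (w < u)%N]| < #|O|)%N.
  move=> uO; apply/proper_card/properP; split.
    by apply/subsetP => w; rewrite inE => /andP[].
  by exists u; rewrite // inE ltnn andbF.
have [->|[u0 u0O]] := set_0Vmem O.
  by rewrite big_set0 /rank_sum cards0 big_ord0.
have O0 : (0 < #|O|)%N by apply/card_gt0P; exists u0.
pose k := #|O|.-1; have kE : #|O| = k.+1 by rewrite prednK.
pose rk u : 'I_k.+1 := inord #|[set w in O | (w < u)%N]|.
have rkE u : u \in O -> rk u = #|[set w in O | (w < u)%N]| :> nat.
  by move=> uO; rewrite inordK // -kE below.
have rk_lt u w : u \in O -> w \in O -> (u < w)%N -> (rk u < rk w)%N.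
  move=> uO wO lt; rewrite !rkE //; apply/proper_card/properP; split.
    apply/subsetP => c; rewrite !inE => /andP[-> /=]; move/ltn_trans; exact.
  by exists u; rewrite !inE ?uO ?lt // ltnn.
have rk_inj : {in O &, injective rk}.
  move=> u w uO wO e; apply/val_inj; case: (ltngtP u w) => // /rk_lt;
    by rewrite e ltnn uO wO => /(_ isT isT).
have above u : u \in O -> #|[set w in O | (u < w)%N]| = (k - rk u)%N.
  move=> uO; rewrite rkE //; have := cardsID [set w : 'I_n | (w < u)%N] O.
  have -> : O :&: [set w : 'I_n | (w < u)%N] = [set w in O | (w < u)%N].
    by apply/setP => w; rewrite !inE.
  rewrite (cardsD1 u (O :\: _)) !inE uO ltnn kE /=.
  have -> : (O :\: [set w : 'I_n | (w < u)%N]) :\ u = [set w in O | (u < w)%N].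
    apply/setP => w; rewrite !inE -val_eqE /=.
    by case: (w \in O); rewrite ?andbF ?andbT //=; case: ltngtP.
  by move=> e; rewrite -[k]/(k.+1.-1) -e add1n addnS addKn.
have rk_onto : [set rk u | u in O] = setT.
  by apply/eqP; rewrite eqEcard subsetT cardsT card_ord (card_in_imset rk_inj) kE /=.
rewrite /rank_sum kE /= (eq_bigl (mem [set rk u | u in O])); last first.
  by move=> a; rewrite /= rk_onto inE.
rewrite big_imset //=; apply: eq_bigr => u uO.
by rewrite above // rkE.
Qed.

Lemma sum_choosable (O : {set 'I_n}) (F : option 'I_n -> R) :
  \sum_(o | choosable O o) F o = F None + \sum_(u in O) F (Some u).
Proof.
rewrite (bigD1 None) //=; congr (_ + _).
rewrite (reindex_omap Some id) /=; last by case.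
by apply: eq_bigl => u; rewrite andbT eqxx andbT.
Qed.

(** The three terms are a valley (height [k + 1] afterwards), a level step of
either kind, and a peak (height [k - 1], two independent closures). When
[k = 0] the last two vanish with [rank_sum 0 = 0], so truncation in [k.-1] does
no harm. The marks of the level steps occur through [y + z] only. *)
Definition step_sum (y z t : R) (phi : nat -> R) (k : nat) : R :=
  d k * (phi k.+1 + (y + z) * rank_sum k * phi k
         + t * rank_sum k ^+ 2 * phi k.-1).

Lemma prod_upd y z t g m o :
  \prod_(j < n | (j < m)%N) step_weight y z t (upd g m o) j =
  \prod_(j < n | (j < m)%N) step_weight y z t g j.
Proof.
apply: eq_bigr => j lj; rewrite /step_weight.
have [-> ->] := open_upd g o (ltnW lj).
by rewrite /up /dn upd_ltE.
Qed.

Lemma sum_steps y z t (phi : nat -> R) g m : valid m g ->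
  \sum_(o | choosable (openP g m) o.1 && choosable (openV g m) o.2)
     phi #|openP (upd g m o) m.+1| * step_weight y z t (upd g m o) m =
  step_sum y z t phi #|openP g m|.
Proof.
move=> /validP[leg _]; set O := openP g m; set O' := openV g m.
have cO : #|O'| = #|O| by rewrite -card_openPV // ltnW.
have cardO o : choosable O o.1 && choosable O' o.2 ->
    #|openP (upd g m o) m.+1| = (#|O| + ~~ isSome o.2 - isSome o.1)%N.
  move=> cho.
  have [|+ _] := @card_open_step (upd g m o) m.
    move=> j; rewrite leq_eqVlt => /orP[/eqP/val_inj ->|lj].
      by rewrite /legal; have [-> ->] := open_upd g o (leqnn m); rewrite /up /dn updE.
    by rewrite legal_upd ?leg.
  have [-> _] := open_upd g o (leqnn m); rewrite /up /dn updE => <-.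
  by rewrite addnK.
under eq_bigr => o cho.
  rewrite cardO // /step_weight; have [-> ->] := open_upd g o (leqnn m).
  rewrite /up /dn updE -/O -/O'; over.
rewrite -(pair_big_dep (choosable O) (fun _ => choosable O')
  (fun ou ow => phi (#|O| + ~~ isSome ow - isSome ou)%N *
     (d #|O| * rank_weight O ou * rank_weight O' ow * type_weight y z t ou ow))) /=.
set S := \sum_(u in O) rank_weight O (Some u).
set S' := \sum_(w in O') rank_weight O' (Some w).
have [sumO sumO'] : S = rank_sum #|O| /\ S' = rank_sum #|O|.
  by rewrite -{2}cO -!sum_rank_weight.
rewrite sum_choosable !sum_choosable.
under [X in _ + X]eq_bigr => u _ do rewrite sum_choosable.
rewrite big_split addrA.
transitivity (d #|O| * phi #|O|.+1 + d #|O| * phi #|O| * z * S'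
   + d #|O| * phi #|O| * y * S + d #|O| * t * phi #|O|.-1 * (S * S')); last first.
  by rewrite sumO sumO' /step_sum; ring.
congr (_ + _ + _ + _).
- by rewrite /= subn0 addn1; ring.
- by rewrite mulr_sumr; apply: eq_bigr => w _; rewrite /= subn0 addn0; ring.
- by rewrite mulr_sumr; apply: eq_bigr => u _; rewrite /= addn1 subn1; ring.
- rewrite mulr_suml mulr_sumr; apply: eq_bigr => u _.
  rewrite !mulr_sumr; apply: eq_bigr => w _; rewrite /= addn0 subn1; ring.
Qed.

(** The function [phi] of the final height is there for the induction: removing
the last step turns it into [step_sum y z t phi], a function of [y + z]. *)
Lemma sum_hist_balance y z y' z' t : y + z = y' + z' ->
  forall (k : nat) (phi : nat -> R), (k <= n)%N ->
  \sum_(g | valid k g) phi #|openP g k| *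
     \prod_(j < n | (j < k)%N) step_weight y z t g j =
  \sum_(g | valid k g) phi #|openP g k| *
     \prod_(j < n | (j < k)%N) step_weight y' z' t g j.
Proof.
move=> yz; elim=> [|k IH] phi lk; first by apply: eq_bigr => g _; rewrite !big_pred0.
pose m := Ordinal lk; rewrite -[k.+1]/(m.+1).
have step y0 z0 :
   \sum_(g | valid m.+1 g) phi #|openP g m.+1| *
      \prod_(j < n | (j < m.+1)%N) step_weight y0 z0 t g j =
   \sum_(g | valid m g) step_sum y0 z0 t phi #|openP g m| *
      \prod_(j < n | (j < m)%N) step_weight y0 z0 t g j.
  rewrite sum_hist_step; apply: eq_bigr => g val.
  rewrite -(sum_steps _ _ _ _ val) mulr_suml; apply: eq_bigr => o _.
  rewrite -mulrA; congr (_ * _).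
  rewrite (bigD1 m) //=; congr (_ * _); rewrite -(prod_upd y0 z0 t g m o).
  by apply: eq_bigl => j; rewrite ltnS andbC [RHS]ltn_neqAle.
have -> := step y z; have -> := step y' z'.
have -> : step_sum y z t phi = step_sum y' z' t phi by rewrite /step_sum yz.
exact: (IH (step_sum y' z' t phi) (ltnW lk)).
Qed.

End Weights.

(** * Derangements as closed histories *)

Local Open Scope nat_scope.

Definition hist_of (sigma : 'S_n) : history :=
  [ffun j => (if (sigma^-1)%g j < j then Some ((sigma^-1)%g j) else None,
              if sigma j < j then Some (sigma j) else None)].

(** The excedance arcs [u -> sigma u] that pass over, or end at, the index [k]. *)
Definition spanning (sigma : 'S_n) (k : nat) : {set 'I_n} :=
  [set u : 'I_n | u < k <= sigma u].

Lemma derangementP (sigma : 'S_n) :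
  reflect (forall i, sigma i != i) (sigma \in derangements n).
Proof.
rewrite inE /nfix cards_eq0; apply: (iffP eqP) => [H i|H].
  by have /setP/(_ i) := H; rewrite !inE => ->.
by apply/setP => i; rewrite !inE (negPf (H i)).
Qed.

Lemma derangement_neq (sigma : 'S_n) i : sigma \in derangements n ->
  sigma i <> i :> nat.
Proof. by move=> /derangementP/(_ i)/eqP H /val_inj. Qed.

Lemma derangementV (sigma : 'S_n) : sigma \in derangements n ->
  (sigma^-1)%g \in derangements n.
Proof.
move=> /derangementP H; apply/derangementP => i; apply/eqP => e.
by have := H i; rewrite -{1}e permKV eqxx.
Qed.

Lemma up_hist_of sigma j :
  up (hist_of sigma) j = if (sigma^-1)%g j < j then Some ((sigma^-1)%g j) else None.
Proof. by rewrite /up ffunE. Qed.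

Lemma dn_hist_of sigma j :
  dn (hist_of sigma) j = if sigma j < j then Some (sigma j) else None.
Proof. by rewrite /dn ffunE. Qed.

Lemma dn_hist_of_up sigma j :
  dn (hist_of sigma) j = up (hist_of (sigma^-1)%g) j.
Proof. by rewrite dn_hist_of up_hist_of invgK. Qed.

Lemma openP_hist_of sigma k : sigma \in derangements n ->
  openP (hist_of sigma) k = spanning sigma k.
Proof.
move=> der; apply/setP => u; rewrite [RHS]inE; apply/unusedP/andP => -[lu].
  rewrite dn_hist_of; case: ltnP => // le _ H; split=> //.
  rewrite leqNgt; apply/negP => /H; rewrite up_hist_of permK.
  by rewrite ltn_neqAle le andbT; case: eqP => // e; case: (derangement_neq der (esym e)).
move=> le; have lt := leq_trans lu le; split=> //.
  by rewrite dn_hist_of ltnNge (ltnW lt).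
move=> c lc; rewrite up_hist_of; case: ifP => // _ [e].
by move: le; rewrite -e permKV leqNgt lc.
Qed.

Lemma openV_hist_of sigma k : sigma \in derangements n ->
  openV (hist_of sigma) k = spanning (sigma^-1)%g k.
Proof.
move=> der; rewrite -openP_hist_of ?derangementV //.
by apply: eq_unused => j _; rewrite dn_hist_of_up ?invgK.
Qed.

Lemma legal_hist_of sigma j : sigma \in derangements n -> legal (hist_of sigma) j.
Proof.
move=> der; rewrite /legal openP_hist_of // openV_hist_of // up_hist_of dn_hist_of.
case: ifP => /= lt1; case: ifP => /= lt2; rewrite ?inE ?permK ?permKV ?lt1 ?lt2 //=;
  by rewrite ?leqnn.
Qed.

Lemma card_spanning_inv sigma k : sigma \in derangements n -> k <= n ->
  #|spanning (sigma^-1)%g k| = #|spanning sigma k|.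
Proof.
move=> der le; rewrite -(openP_hist_of k der) -(openV_hist_of k der).
by rewrite (card_openPV le) // => j _; exact: legal_hist_of.
Qed.

Lemma hist_of_inj : {in derangements n &, injective hist_of}.
Proof.
move=> sigma tau der1 der2 e; apply/permP => j.
have := dn_hist_of sigma j; rewrite e dn_hist_of.
case: (ltnP (sigma j) j) => [lt|]; first by case: ifP => // _ [].
rewrite leq_eqVlt => /orP[/eqP/esym/(derangement_neq der1) //|lt] _.
have := up_hist_of sigma (sigma j); rewrite e up_hist_of permK lt.
by case: ifP => // _ [ej]; rewrite -{2}ej permKV.
Qed.

(** Each position took a smaller letter at its own step or, being closed at the
end, was closed at a later one; legality makes both events unique and
incompatible, which defines [sigma] and makes it injective. *)
Lemma hist_of_onto g : valid n g -> openP g n = set0 ->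
  exists2 sigma, sigma \in derangements n & hist_of sigma = g.
Proof.
move=> /validP[leg _] closed.
have upO j u : up g j = Some u -> u \in openP g j.
  by move=> e; have /andP[+ _] := leg j (ltn_ord j); rewrite e.
have dnO j w : dn g j = Some w -> w \in openV g j.
  by move=> e; have /andP[_] := leg j (ltn_ord j); rewrite e.
have up_inj i j u : up g i = Some u -> up g j = Some u -> i = j.
  move=> ei ej; apply/val_inj; case: (ltngtP i j) => // lt.
    by have /unusedP[_ _ /(_ i lt)] := upO _ _ ej.
  by have /unusedP[_ _ /(_ j lt)] := upO _ _ ei.
have dn_inj i j w : dn g i = Some w -> dn g j = Some w -> i = j.
  move=> ei ej; apply/val_inj; case: (ltngtP i j) => // lt.
    by have /unusedP[_ _ /(_ i lt)] := dnO _ _ ej.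
  by have /unusedP[_ _ /(_ j lt)] := dnO _ _ ei.
have image u : exists i, dn g u = Some i \/ up g i = Some u.
  case e: (dn g u) => [w|]; first by exists w; left.
  have [/existsP[c /eqP ec]|/existsPn H] := boolP [exists c, up g c == Some u].
    by exists c; right.
  have : u \in openP g n.
    by apply/unusedP; split=> // c _ ec; have := H c; rewrite ec eqxx.
  by rewrite closed inE.
(* By [image] the default [u] is never taken. *)
pose f u := if dn g u is Some w then w
            else odflt u [pick c | up g c == Some u].
have fP u : dn g u = Some (f u) \/ up g (f u) = Some u.
  rewrite /f; case e: (dn g u) => [w|]; first by left.
  case: pickP => [c /eqP ec|H]; first by right.
  by have [c []] := image u; rewrite ?e // => ec; have := H c; rewrite ec eqxx.
have f_inj : injective f.
  move=> u w e; have := fP u; rewrite e.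
  case=> eu; case: (fP w) => ew; first exact: dn_inj eu ew.
  - by have /unusedP[_] := dnO _ _ eu; rewrite ew.
  - by have /unusedP[_] := dnO _ _ ew; rewrite eu.
  - by move: eu; rewrite ew => -[].
have dn_f u : dn g u = Some (f u) -> f u < u by move=> /dnO/unusedP[].
have up_f u : up g (f u) = Some u -> u < f u by move=> /upO/unusedP[].
exists (perm f_inj).
  apply/derangementP => i; rewrite permE -val_eqE /=.
  by case: (fP i) => [/dn_f|/up_f]; case: ltngtP.
apply/ffunP => j; rewrite [LHS]surjective_pairing [RHS]surjective_pairing.
congr (_, _).
  rewrite -[LHS]/(up _ j) up_hist_of; set i := (perm f_inj)^-1%g j.
  have fi : f i = j by rewrite -[f i]permE permKV.
  rewrite -/(up g j); case: (fP i); rewrite fi => e.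
    have lt := dn_f i; rewrite fi e in lt; rewrite ltnNge (ltnW (lt erefl)) /=.
    by have /unusedP[_ ->] := dnO _ _ e.
  by have := up_f i; rewrite fi e => ->.
rewrite -[LHS]/(dn _ j) dn_hist_of permE -/(dn g j).
case: (fP j) => e; first by rewrite (dn_f _ e) e.
rewrite ltnNge (ltnW (up_f _ e)) /=.
by have /unusedP[_ ->] := upO _ _ e.
Qed.

Local Open Scope ring_scope.

(** Marks may be moved between cyclic double ascents and cyclic double
descents, as long as their sum is kept. *)
Lemma sum_derangements (R : comNzRingType) (v : nat -> nat -> R) (d : nat -> R)
    (y z t y' z' : R) : y + z = y' + z' ->
  \sum_(sigma in derangements n) \prod_j step_weight v d y z t (hist_of sigma) j =
  \sum_(sigma in derangements n) \prod_j step_weight v d y' z' t (hist_of sigma) j.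
Proof.
move=> yz.
have sumE y0 z0 :
    \sum_(sigma in derangements n) \prod_j step_weight v d y0 z0 t (hist_of sigma) j =
    \sum_(g | valid n g) (#|openP g n| == 0)%:R *
       \prod_(j < n | (j < n)%N) step_weight v d y0 z0 t g j.
  (* The factor [#|openP g n| == 0] selects the histories of derangements. *)
  rewrite -(big_imset (fun g => \prod_j step_weight v d y0 z0 t g j) hist_of_inj) /=.
  under [RHS]eq_bigr do rewrite mulr_natl mulrb.
  rewrite -big_mkcondr /=; apply: eq_big => [g|g _]; last first.
    by apply: eq_bigl => j; rewrite ltn_ord.
  rewrite cards_eq0; apply/imsetP/andP => [[sigma der ->]|[val /eqP closed]].
    split; first by apply/validP; split=> j; [move=> _; exact: legal_hist_of|
      rewrite leqNgt ltn_ord].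
    rewrite openP_hist_of //; apply/eqP/setP => u.
    by rewrite !inE; apply/negP => /andP[_]; rewrite leqNgt ltn_ord.
  by have [sigma der <-] := hist_of_onto val closed; exists sigma.
rewrite !sumE.
exact: (sum_hist_balance v d t yz (fun k => (k == 0)%:R) (leqnn n)).
Qed.

(** * Statistics of a derangement from its excedance arcs *)

Local Open Scope nat_scope.

Lemma card_pairs (Q : 'I_n * 'I_n -> bool) :
  #|[set ij | Q ij]| = \sum_i \sum_j Q (i, j).
Proof.
rewrite -sum1_card pair_bigA big_mkcond /=; apply: eq_bigr => -[i j] _.
by rewrite inE; case: (Q _).
Qed.

Lemma card_setb (Q : 'I_n -> bool) : #|[set i | Q i]| = \sum_i Q i.
Proof.
rewrite -sum1_card big_mkcond; apply: eq_bigr => i _.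
by rewrite inE; case: (Q i).
Qed.

Lemma sum_perm (sigma : 'S_n) (F : 'I_n -> nat) : \sum_i F i = \sum_i F (sigma i).
Proof. exact: (reindex_inj (@perm_inj _ sigma)). Qed.

Definition cdd (sigma : 'S_n) := #|[set i | sigma i < i < (sigma^-1)%g i]|.
Definition cpk (sigma : 'S_n) := #|[set i | ((sigma^-1)%g i < i) && (sigma i < i)]|.

(** For an excedance [i], the arcs still open when [i -> sigma i] closes are
those that contain it, counted by [below], and those that cross it, counted by
[above]. *)
Definition below (sigma : 'S_n) i := #|[set w in spanning sigma (sigma i) | w < i]|.
Definition above (sigma : 'S_n) i := #|[set w in spanning sigma (sigma i) | i < w]|.

Definition nestP (sigma : 'S_n) := \sum_(i < n | i < sigma i) below sigma i.
Definition crosP (sigma : 'S_n) := \sum_(i < n | i < sigma i) above sigma i.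
Definition lmaxP (sigma : 'S_n) := \sum_(i < n | i < sigma i) (below sigma i == 0).

Lemma nestPE sigma :
  nestP sigma = \sum_(i < n) \sum_(w < n) [&& w < i, i < sigma i & sigma i < sigma w].
Proof.
rewrite /nestP big_mkcond; apply: eq_bigr => i _; rewrite /below card_setb.
case: ifP => lt; last by rewrite big1 // => w _; rewrite andbF.
apply: eq_bigr => w _; rewrite inE.
have [->|nw] := eqVneq w i; first by rewrite ltnn andbF.
have : sigma i != sigma w by rewrite (inj_eq perm_inj) eq_sym.
by rewrite -val_eqE /=; lia.
Qed.

Lemma crosPE sigma :
  crosP sigma = \sum_(i < n) \sum_(w < n) [&& i < w, w < sigma i & sigma i < sigma w].
Proof.
rewrite /crosP big_mkcond; apply: eq_bigr => i _; rewrite /above card_setb.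
case: ifP => lt; last by rewrite big1 // => w _; lia.
apply: eq_bigr => w _; rewrite inE.
have [->|nw] := eqVneq w i; first by rewrite ltnn andbF.
have : sigma i != sigma w by rewrite (inj_eq perm_inj) eq_sym.
by rewrite -val_eqE /=; lia.
Qed.

Lemma ndrop_exc_inv (sigma : 'S_n) : ndrop sigma = exc (sigma^-1)%g.
Proof.
rewrite /ndrop /exc !card_setb [RHS](sum_perm sigma).
by apply: eq_bigr => i _; rewrite permK.
Qed.

(** The extra 1 is the arc of [i] itself. *)
Lemma card_spanning_exc (sigma : 'S_n) (i : 'I_n) : i < sigma i ->
  #|spanning sigma (sigma i)| = below sigma i + above sigma i + 1.
Proof.
move=> lt; rewrite /below /above /spanning !card_setb.
rewrite (bigD1 i) // [X in X + _ + _](bigD1 i) // [X in _ + X + _](bigD1 i) //=.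
rewrite !inE !ltnn !andbF lt leqnn /= !add0n addnC; congr (_ + _).
rewrite -big_split; apply: eq_bigr => w; rewrite -val_eqE inE /=; lia.
Qed.

Lemma sum_card_spanning_exc (sigma : 'S_n) :
  \sum_(i < n | i < sigma i) #|spanning sigma (sigma i)| =
  nestP sigma + crosP sigma + exc sigma.
Proof.
rewrite /nestP /crosP /exc -sum1dep_card -!big_split.
by apply: eq_bigr => i; exact: card_spanning_exc.
Qed.

Section Derangement.
Variables (sigma : 'S_n) (der : sigma \in derangements n).
Let tau := (sigma^-1)%g.

Let sigma_neq i : sigma i <> i :> nat. Proof. exact: derangement_neq. Qed.
Let tau_neq i : tau i <> i :> nat. Proof. exact/derangement_neq/derangementV. Qed.

(** A lower nesting of [sigma] is an upper nesting of [sigma^-1] between the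
letters: substitute letters for positions. *)
Lemma nest_split : nest sigma = nestP sigma + nestP tau.
Proof.
rewrite /nest card_pairs !nestPE exchange_big /=.
rewrite [X in _ + X](sum_perm sigma).
under [X in _ + X]eq_bigr => i _ do rewrite (sum_perm sigma) permK.
rewrite -big_split; apply: eq_bigr => j _; rewrite -big_split; apply: eq_bigr => i _.
have := @sigma_neq j; rewrite /= permK; lia.
Qed.

(** The term [cda] is the boundary case [j = sigma i] of an upper crossing, which
has no counterpart among the lower ones. *)
Lemma cros_split : cros sigma = crosP sigma + crosP tau + cda sigma.
Proof.
have -> : cda sigma = \sum_(i < n) \sum_(j < n) [&& j == sigma i, i < j & j < sigma j].
  rewrite /cda card_setb (sum_perm sigma); apply: eq_bigr => i _.
  rewrite permK (bigD1 (sigma i)) //= eqxx big1 ?addn0 // => j /negPf -> //.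
rewrite /cros card_pairs !crosPE [X in _ + X + _]exchange_big.
rewrite [X in _ + X + _](sum_perm sigma).
under [X in _ + X + _]eq_bigr => i _ do rewrite (sum_perm sigma) permK.
rewrite -!big_split; apply: eq_bigr => i _; rewrite -!big_split; apply: eq_bigr => j _.
by rewrite /= permK -val_eqE /=; lia.
Qed.

Lemma exc_split : exc sigma = cda sigma + cpk sigma.
Proof.
rewrite /exc /cda /cpk !card_setb -/tau (sum_perm tau) -big_split.
by apply: eq_bigr => i _ /=; rewrite permKV; have := @sigma_neq i; lia.
Qed.

Lemma ndrop_split : ndrop sigma = cdd sigma + cpk sigma.
Proof.
rewrite /ndrop /cdd /cpk !card_setb -/tau -big_split.
by apply: eq_bigr => i _ /=; have := @tau_neq i; lia.
Qed.

Lemma exc_add_ndrop : exc sigma + ndrop sigma = n.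
Proof.
rewrite /exc /ndrop !card_setb -big_split -[RHS]muln1 -[in RHS](card_ord n) -sum_nat_const.
by apply: eq_bigr => i _ /=; have := @sigma_neq i; lia.
Qed.

End Derangement.

Lemma sum_interval (a b : nat) k : \sum_(j < k) (a < j <= b) = minn b k.-1 - a.
Proof.
elim: k => [|k IH]; first by rewrite big_ord0; lia.
by rewrite big_ord_recr IH /=; case: k {IH}; lia.
Qed.

(** An arc from [i] to [sigma i] lies over [sigma i - i] indices. *)
Lemma sum_card_spanning (sigma : 'S_n) : \sum_(j < n) #|spanning sigma j| = depth sigma.
Proof.
under eq_bigr do rewrite card_setb.
rewrite exchange_big /depth [RHS]big_mkcond; apply: eq_bigr => i _.
rewrite sum_interval; have := ltn_ord (sigma i); case: ifP; lia.
Qed.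

Lemma rmin_inv (sigma : 'S_n) : rmin sigma = lmax (sigma^-1)%g.
Proof.
rewrite /rmin /lmax !card_setb [RHS](sum_perm sigma); apply: eq_bigr => i _.
congr nat_of_bool; rewrite permK; apply/forallP/forallP => H j.
  apply/implyP => lt; rewrite ltnNge leq_eqVlt; apply/negP => /orP[/eqP/val_inj e|lt'].
    by move: lt; rewrite e permKV ltnn.
  by have := implyP (H _) lt'; rewrite permKV ltnNge (ltnW lt).
apply/implyP => lt; rewrite ltnNge leq_eqVlt; apply/negP => /orP[/eqP/val_inj/perm_inj e|lt'].
  by move: lt; rewrite e ltnn.
by have := implyP (H _) lt'; rewrite permK ltnNge (ltnW lt).
Qed.

(** A left-to-right maximum of a derangement is an excedance, since the [i]
letters before it must all be below [sigma i]; and an excedance is one exactly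
when no other excedance arc contains its arc. *)
Lemma lmaxPE (sigma : 'S_n) : sigma \in derangements n -> lmaxP sigma = lmax sigma.
Proof.
move=> der; rewrite /lmaxP big_mkcond /lmax card_setb; apply: eq_bigr => i _.
case: (ltngtP i (sigma i)) => [lt|gt|/esym/(derangement_neq der) //].
  congr nat_of_bool; rewrite cards_eq0; apply/eqP/forallP => [H j|H].
    apply/implyP => lj; move/setP/(_ j): H; rewrite !inE lj andbT => /negbT.
    by rewrite (ltn_trans lj lt) /= -ltnNge.
  apply/setP => j; rewrite !inE; apply/negP => /andP[/andP[_ le] lj].
  by have := implyP (H j) lj; rewrite ltnNge le.
case: forallP => // H.
have : [set sigma j | j in [set j : 'I_n | j < i]] \subset [set k : 'I_n | k < sigma i].
  apply/subsetP => k /imsetP[j]; rewrite inE => lj ->; rewrite inE.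
  exact: (implyP (H j)).
move/subset_leq_card; rewrite card_imset; last exact: perm_inj.
have cardlt (k : 'I_n) : #|[set j : 'I_n | j < k]| = k.
  rewrite -sum1dep_card -(big_ord_widen n (fun=> 1) (ltnW (ltn_ord k))).
  by rewrite sum1_card card_ord.
by rewrite !cardlt leqNgt gt.
Qed.

(** An inversion between two excedances or two drops is a nesting. The others
pair an excedance [i] with a drop [j] whose arcs overlap. Count such a pair
when the first of its two arcs closes. If the excedance arc closes first, at
[sigma i], there is one drop arc per open letter, that is, as many as open
positions ([closeP]). If the drop arc closes first, at [j], there is one
excedance arc per open position ([closeV]), except that one closing at the
same index [j] was already counted; this happens at the cyclic peaks. *)
Lemma inv_split (sigma : 'S_n) : sigma \in derangements n ->
  Defs.inv sigma = ndrop sigma + cros sigma + 2 * nest sigma.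
Proof.
move=> der; set tau := (sigma^-1)%g.
have dert : tau \in derangements n by exact: derangementV.
have sigma_neq i : sigma i <> i :> nat by exact: derangement_neq.
have closeP : \sum_(i < n) \sum_(j < n) [&& i < sigma i, sigma j < sigma i & sigma i <= j] =
    nestP sigma + crosP sigma + exc sigma.
  rewrite -sum_card_spanning_exc [RHS]big_mkcond; apply: eq_bigr => i _.
  case: ifP => lt; last by rewrite big1.
  rewrite -card_spanning_inv ?(ltnW (ltn_ord _)) // /spanning card_setb [RHS](sum_perm sigma).
  by apply: eq_bigr => j _; rewrite permK.
have closeV : \sum_(i < n) \sum_(j < n) [&& sigma j < j, i < j & j <= sigma i] =
    nestP tau + crosP tau + ndrop sigma.
  rewrite ndrop_exc_inv -sum_card_spanning_exc [RHS]big_mkcond exchange_big.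
  rewrite [RHS](sum_perm sigma); apply: eq_bigr => j _; rewrite permK.
  case: ifP => lt; last by rewrite big1.
  by rewrite card_spanning_inv ?(ltnW (ltn_ord _)) // /spanning card_setb.
have cpkE : cpk sigma = \sum_(i < n) \sum_(j < n) [&& j == sigma i, i < j & sigma j < j].
  rewrite /cpk card_setb (sum_perm sigma); apply: eq_bigr => i _.
  by rewrite permK (bigD1 (sigma i)) //= eqxx big1 ?addn0 // => j /negPf ->.
have invE : Defs.inv sigma + cpk sigma =
    nestP sigma + nestP tau +
    (\sum_(i < n) \sum_(j < n) [&& i < sigma i, sigma j < sigma i & sigma i <= j] +
     \sum_(i < n) \sum_(j < n) [&& sigma j < j, i < j & j <= sigma i]).
  have -> : nestP sigma =
      \sum_(i < n) \sum_(j < n) [&& i < j, j < sigma j & sigma j < sigma i].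
    by rewrite nestPE exchange_big.
  have -> : nestP tau =
      \sum_(i < n) \sum_(j < n) [&& sigma j < sigma i, sigma i < i & i < j].
    rewrite nestPE (sum_perm sigma); apply: eq_bigr => i _.
    by rewrite (sum_perm sigma) permK; apply: eq_bigr => j _; rewrite permK.
  rewrite /Defs.inv card_pairs cpkE.
  rewrite -!big_split; apply: eq_bigr => i _; rewrite -!big_split; apply: eq_bigr => j _.
  have := @sigma_neq i; have := @sigma_neq j; rewrite /= -val_eqE /=.
  lia.
have := cros_split der; have := nest_split der; have := exc_split der.
rewrite closeP closeV in invE; rewrite -/tau; lia.
Qed.

(** * The gamma expansion *)

Local Open Scope ring_scope.

Lemma prod_step_weight (R : comNzRingType) (y z t h alpha p q : R) (sigma : 'S_n) :
  sigma \in derangements n ->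
  \prod_j step_weight (fun i k : nat => q ^+ i * p ^+ k * alpha ^+ (i == 0%N))
             (fun k => h ^+ k) y z t (hist_of sigma) j =
  y ^+ cda sigma * z ^+ cdd sigma * t ^+ cpk sigma
  * h ^+ depth sigma * alpha ^+ (lmax sigma + rmin sigma)
  * p ^+ (crosP sigma + crosP (sigma^-1)%g) * q ^+ nest sigma.
Proof.
move=> der; set v := fun i k : nat => _; set tau := (sigma^-1)%g.
have dert : tau \in derangements n by exact: derangementV.
have upE rho : \prod_(j < n) rank_weight v (spanning rho j) (up (hist_of rho) j) =
    q ^+ nestP rho * p ^+ crosP rho * alpha ^+ lmaxP rho.
  rewrite /nestP /crosP /lmaxP -!prodrXr -!big_split /=.
  rewrite [RHS]big_mkcond (reindex_inj (@perm_inj _ rho)) /=; apply: eq_bigr => i _.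
  by rewrite up_hist_of permK; case: ifP.
have typeE : \prod_j type_weight y z t (isSome (up (hist_of sigma) j))
      (isSome (dn (hist_of sigma) j)) =
    y ^+ cda sigma * z ^+ cdd sigma * t ^+ cpk sigma.
  rewrite /cda /cdd /cpk !card_setb -!prodrXr -!big_split /=; apply: eq_bigr => i _.
  rewrite up_hist_of dn_hist_of -/tau.
  have := derangement_neq (i := i) der; have := derangement_neq (i := i) dert.
  by case: (ltngtP (tau i) i) => //=; case: (ltngtP (sigma i) i) => //=;
    rewrite !expr0 ?expr1 ?mulr1 ?mul1r.
rewrite !big_split /= typeE.
have -> : \prod_(j < n) h ^+ #|openP (hist_of sigma) j| = h ^+ depth sigma.
  by rewrite prodrXr -sum_card_spanning; under eq_bigr do rewrite openP_hist_of //.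
under [X in _ * X * _ * _]eq_bigr do rewrite openP_hist_of //.
under [X in _ * X * _]eq_bigr do rewrite openV_hist_of // dn_hist_of_up.
rewrite !upE rmin_inv nest_split // -!lmaxPE // -/tau !exprD.
ring.
Qed.

Lemma sum_derangements_cda0 (R : comNzRingType) (y z t h alpha p q : R) :
  \sum_(sigma in derangements n)
    y ^+ cda sigma * z ^+ cdd sigma * t ^+ cpk sigma
    * h ^+ depth sigma * alpha ^+ (lmax sigma + rmin sigma)
    * p ^+ (crosP sigma + crosP (sigma^-1)%g) * q ^+ nest sigma =
  \sum_(0 <= k < n./2.+1) \sum_(sigma in derangements0 n k)
    (y + z) ^+ (n - 2 * k) * t ^+ k
    * h ^+ depth sigma * alpha ^+ (lmax sigma + rmin sigma)
    * p ^+ (crosP sigma + crosP (sigma^-1)%g) * q ^+ nest sigma.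
Proof.
have weightE y0 z0 := eq_bigr _ (fun sigma der =>
  esym (prod_step_weight y0 z0 t h alpha p q (sigma := sigma) der)).
rewrite weightE (@sum_derangements _ _ _ y z t 0 (y + z)) ?add0r // -weightE.
have count sigma : sigma \in derangements n -> cda sigma = 0%N ->
    cpk sigma = exc sigma /\ (cdd sigma = n - 2 * exc sigma)%N /\ (exc sigma < n./2.+1)%N.
  move=> der c0; have := exc_split der; have := ndrop_split der.
  have := exc_add_ndrop der; lia.
rewrite big_mkord.
rewrite (bigID (fun sigma => cda sigma == 0%N)) /= [X in _ + X]big1 ?addr0; last first.
  by move=> sigma /andP[_]; rewrite -lt0n => /prednK <-; rewrite exprS !mul0r.
rewrite (partition_big (fun sigma => inord (exc sigma) : 'I_n./2.+1) xpredT) //=.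
apply: eq_bigr => k _; apply: eq_big => sigma.
  rewrite !inE -andbA; case: (boolP (nfix sigma == 0%N)) => //= fx.
  case: eqP => //= c0; rewrite -val_eqE /= inordK //.
  by have [||_ []] := count sigma; rewrite ?inE.
move=> /andP[/andP[der /eqP c0] /eqP ek].
have [-> [-> lt]] := count sigma der c0.
have <- : exc sigma = k by rewrite -ek inordK.
by rewrite c0 expr0 mul1r.
Qed.

End Histories.

Local Open Scope ring_scope.

Theorem corollary2p8 (R : comNzRingType) (n : nat) (x s h alpha p q : R) :
  C1 n x s h alpha p q
    = \sum_(0 <= k < n./2.+1)
        gamma1 n k s h alpha p q * x ^+ k * (1 + x) ^+ (n - 2 * k)
  /\
  C2 n x s h alpha p q
    = \sum_(0 <= k < n./2.+1)
        gamma2 n k s h alpha p q * x ^+ k * (1 + x) ^+ (n - 2 * k).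
Proof.
have statE (sigma : 'S_n) : sigma \in derangements n ->
    [/\ exc sigma = (cda sigma + cpk sigma)%N,
        ndrop sigma = (cdd sigma + cpk sigma)%N,
        cros sigma = (crosP sigma + crosP (sigma^-1)%g + cda sigma)%N &
        Defs.inv sigma = (ndrop sigma + cros sigma + (nest sigma + nest sigma))%N].
  move=> der; split; [exact: exc_split|exact: ndrop_split|exact: cros_split|].
  by rewrite addnn -mul2n; exact: inv_split.
have cda0E k (sigma : 'S_n) : sigma \in derangements0 n k ->
    [/\ sigma \in derangements n, cda sigma = 0%N & ndrop sigma = (n - 2 * k + k)%N].
  rewrite inE => /andP[der /andP[/eqP c0 /eqP ek]]; split=> //.
  have := exc_split der; have := ndrop_split der; have := exc_add_ndrop der; lia.
split.
  (* By [inv = ndrop + cros + 2 nest], each drop and each crossing carries one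
     [s] and each nesting two; a double ascent is also a crossing. *)
  transitivity (\sum_(sigma in derangements n)
      (x * s) ^+ cda sigma * s ^+ cdd sigma * (x * s) ^+ cpk sigma
      * h ^+ depth sigma * alpha ^+ (lmax sigma + rmin sigma)
      * (p * s) ^+ (crosP sigma + crosP (sigma^-1)%g) * (q * s * s) ^+ nest sigma).
    apply: eq_bigr => sigma /statE[-> nd -> ->].
    by rewrite addnK nd !exprMn !exprD; ring.
  rewrite sum_derangements_cda0 //; apply: eq_bigr => k _.
  rewrite /gamma1 !mulr_suml; apply: eq_bigr => sigma /cda0E[der c0 nd].
  have [_ _ -> ->] := statE _ der.
  rewrite nd c0 addn0 -[X in x * s + X]mul1r -mulrDl !exprMn !exprD [1 + x]addrC; ring.
transitivity (\sum_(sigma in derangements n)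
    (x * s * p) ^+ cda sigma * (s * p) ^+ cdd sigma * (x * s * p) ^+ cpk sigma
    * h ^+ depth sigma * alpha ^+ (lmax sigma + rmin sigma)
    * (p * s) ^+ (crosP sigma + crosP (sigma^-1)%g) * (q * s * s) ^+ nest sigma).
  apply: eq_bigr => sigma /statE[-> nd -> ->].
  by rewrite nd !exprMn !exprD; ring.
rewrite sum_derangements_cda0 //; apply: eq_bigr => k _.
rewrite /gamma2 !mulr_suml; apply: eq_bigr => sigma /cda0E[der c0 nd].
have [_ _ -> ->] := statE _ der.
rewrite nd c0 addn0 (_ : x * s * p + s * p = (1 + x) * (s * p)); last by ring.
by rewrite !exprMn !exprD; ring.
Qed.
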